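(* Let $\iota\colon AdS_3\to AdS_4$ be the inclusion $(u,t,x,y)\mapsto(u,t,x,y,0)$. Then $\iota(BH_3)\subset BH_4$ and $\iota(\mathscr{H}_3)\subset\mathscr{H}_4$, where $BH_l$ and $\mathscr{H}_l$ denote the black hole and the horizon in $AdS_l$.
   Context: For $l\ge 3$, let $AdS_l\subset\mathbb{R}^{l+1}$ be the set of vectors with coordinates $(u,t,x,y,\ldots)$ (for $l=3$: $(u,t,x,y)$; for $l=4$: $(u,t,x,y,z)$) satisfying $u^2+t^2-x^2-y^2-\cdots=1$. The group $SO(2,l-1)$ of determinant-one matrices preserving this quadratic form acts on $AdS_l$, and $AdS_l=SO(2,l-1)/SO(1,l-1)$ via $[g]=g e_u$, $e_u=(1,0,\ldots,0)$; $g$ is called a representative of $v$ if $g e_u=v$. Singularity: $\mathscr{S}_l=\{v\in AdS_l : t^2-y^2=0\}$. Put $BTZ_l=AdS_l\setminus\mathscr{S}_l$ with the induced topology. Light-like geodesics: for a representative $g$ of $v$ and a direction $w\in S^{l-2}\subset\mathbb{R}^{l-1}$, the light-like geodesic from $v$ in direction $w$ is $s\mapsto g\,(1,-s,s w)^{T}$; its future part is $s>0$. Black hole and free part: a point $v\in BTZ_l$ is free if for every representative $g\in SO(2,l-1)$ of $v$ there is a direction $w\in S^{l-2}$ such that $g(1,-s,sw)^T\notin\mathscr{S}_l$ for all $s>0$. $\mathscr{F}_l$ is the set of free points. The black hole $BH_l=BTZ_l\setminus\mathscr{F}_l$ is thus the set of $v\in BTZ_l$ having a representative $g$ such that for every $w\in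 S^{l-2}$ there is $s>0$ with $g(1,-s,sw)^T\in\mathscr{S}_l$. Horizon: $\mathscr{H}_l$ is the topological boundary of $BH_l$ in $BTZ_l$. *)

(* Defs.v *)
From mathcomp Require Import all_boot all_order all_algebra.
From mathcomp Require Import all_classical all_reals all_analysis.

Import Order.TTheory GRing.Theory Num.Theory.
Import numFieldNormedType.Exports.

Local Open Scope classical_set_scope.
Local Open Scope ring_scope.

(* Everything is indexed by the dimension [l] of AdS_l, and is only meaningful
   for 3 <= l. The ambient space R^(l+1) is written 'cV[R]_(2 + l.-1), that is,
   as the time-like plane (u, t) followed by the l - 1 space-like coordinates
   (x, y, ...); in particular 2 + l.-1 is convertible to 4 for l = 3 and to 5
   for l = 4. *)
Section AntiDeSitter.
Context {R : realType}.

(* Coordinates are numbered u = 0, t = 1, x = 2, y = 3, z = 4, ... *)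
Definition coord (l k : nat) (v : 'cV[R]_(2 + l.-1)) : R := v (inord k) 0.

Definition qform (l : nat) (v : 'cV[R]_(2 + l.-1)) : R :=
  coord l 0 v ^+ 2 + coord l 1 v ^+ 2 - \sum_(2 <= k < l.+1) coord l k v ^+ 2.

Definition AdS (l : nat) : set 'cV[R]_(2 + l.-1) := [set v | qform l v = 1].

Definition SO2 (l : nat) : set 'M[R]_(2 + l.-1) :=
  [set g | \det g = 1 /\
    forall v : 'cV[R]_(2 + l.-1), qform l (g *m v) = qform l v].

Definition e_u (l : nat) : 'cV[R]_(2 + l.-1) := delta_mx (inord 0) 0.

Definition representative (l : nat) (g : 'M[R]_(2 + l.-1))
    (v : 'cV[R]_(2 + l.-1)) : Prop :=
  SO2 l g /\ g *m e_u l = v.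

Definition singularity (l : nat) : set 'cV[R]_(2 + l.-1) :=
  [set v | AdS l v /\ coord l 1 v ^+ 2 - coord l 3 v ^+ 2 = 0].

Definition BTZ (l : nat) : set 'cV[R]_(2 + l.-1) := AdS l `\` singularity l.

Definition directions (l : nat) : set 'cV[R]_(l.-1) :=
  [set w | \sum_i w i 0 ^+ 2 = 1].

Definition lightlike (l : nat) (g : 'M[R]_(2 + l.-1)) (w : 'cV[R]_(l.-1))
    (s : R) : 'cV[R]_(2 + l.-1) :=
  g *m col_mx (\col_(i < 2) [:: 1; - s]`_i) (s *: w).

Definition free_part (l : nat) : set 'cV[R]_(2 + l.-1) :=
  [set v | BTZ l v /\
    forall g : 'M[R]_(2 + l.-1), representative l g v ->
      exists2 w : 'cV[R]_(l.-1), directions l w &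
        forall s : R, 0 < s -> ~ singularity l (lightlike l g w s)].

Definition black_hole (l : nat) : set 'cV[R]_(2 + l.-1) :=
  BTZ l `\` free_part l.

(* [subspace (BTZ l)] carries the topology induced on BTZ_l; its points outside
   BTZ_l are isolated, hence do not contribute to a boundary. *)
Definition horizon (l : nat) : set 'cV[R]_(2 + l.-1) :=
  closure (black_hole l : set (subspace (BTZ l))) `\`
  interior (black_hole l : set (subspace (BTZ l))).

(* (u, t, x, y) |-> (u, t, x, y, 0) *)
Definition incl34 (v : 'cV[R]_(2 + 3.-1)) : 'cV[R]_(2 + 4.-1) :=
  col_mx (v : 'cV[R]_4) (0 : 'cV[R]_1).

End AntiDeSitter.

Arguments AdS R l : clear implicits.
Arguments singularity R l : clear implicits.
Arguments BTZ R l : clear implicits.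
Arguments free_part R l : clear implicits.
Arguments black_hole R l : clear implicits.
Arguments horizon R l : clear implicits.

(* Main.v *)
Require Import Defs.
From mathcomp Require Import all_boot all_order all_algebra.
From mathcomp Require Import all_classical all_reals all_analysis.
From mathcomp Require Import ring lra.
(* [Defs.coord] must shadow [vector.coord]. *)
Import Defs.
Import Order.TTheory GRing.Theory Num.Theory.
Import numFieldNormedType.Exports.
Local Open Scope classical_set_scope.
Local Open Scope ring_scope.

(* Put [f = t^2 - y^2 = a b] with [a = t - y] and [b = t + y]. On points with
   vanishing coordinates [z, ...], the black hole is [0 < f < 1] in every
   dimension; as [iota] preserves [f], everything then follows from the
   continuity of [iota] and of [f].
   A ray [v + s n], with [n] null and orthogonal to [v], meets the singularity
   at some [s > 0] iff [a (n_t - n_y) < 0] or [b (n_t + n_y) < 0]; the choice of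
   a representative of [v] only selects one of the two halves of the light cone
   at [v], and both halves occur.
   - If [0 < f < 1], then [N = (- f u, t (1 - f), - f x, y (1 - f))] is time-like
     and orthogonal to [v], so [<n, N>] has a constant sign on each half cone.
     Since [<n, N> = n_t t - n_y y], it has the sign of
     [b^2 a (n_t - n_y) + a^2 b (n_t + n_y)].
   - Otherwise explicit null directions in both halves violate both
     inequalities. *)

(** * The Minkowski form in coordinates *)

Section Minkowski.
Context {R : realType} (k : nat).
Local Notation l := k.+3.
Local Notation V := 'cV[R]_(2 + l.-1).

Definition eta_mx : 'M[R]_(2 + l.-1) :=
  diag_mx (row_mx (const_mx 1) (const_mx (-1))).

Definition mink (x y : V) : R := (x^T *m eta_mx *m y) 0 0.

(** The default value of [nth] puts 0 in every coordinate from z on, so one expression describes the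
    points of AdS_3 and their images in AdS_4. *)
Definition vec4 (a b c d : R) : V := \col_i [:: a; b; c; d]`_i.

Lemma lshift_inord (i : 'I_2) : lshift l.-1 i = inord i.
Proof. by apply/val_inj; rewrite /= inordK // (leq_trans (n := 2)). Qed.

Lemma rshift_inord (i : 'I_l.-1) : rshift 2 i = inord i.+2.
Proof. by apply/val_inj; rewrite /= inordK // !ltnS; exact: (ltn_ord i). Qed.

Lemma minkE x y : mink x y = coord l 0 x * coord l 0 y + coord l 1 x * coord l 1 y
  - \sum_(i < l.-1) coord l i.+2 x * coord l i.+2 y.
Proof.
rewrite /mink mul_mx_diag mxE big_split_ord /=; congr (_ + _).
  have split_lshift j : fintype.split (lshift l.-1 j) = inl j by exact: (unsplitK (inl j)).
  by rewrite big_ord_recl big_ord1 !mxE !split_lshift !mxE !mulr1 !lshift_inord.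
rewrite -sumrN; apply: eq_bigr => i _.
have split_rshift (j : 'I_l.-1) : fintype.split (rshift 2 j) = inr j.
  exact: (unsplitK (inr j)).
by rewrite !mxE split_rshift mxE !rshift_inord mulrN1 mulNr.
Qed.

Lemma qform_mink x : qform l x = mink x x.
Proof.
rewrite minkE /qform -!expr2; congr (_ - _).
rewrite -{1}[2%N]add0n big_addn subn2 big_mkord.
by apply: eq_bigr => i _; rewrite addn2 expr2.
Qed.

Lemma minkC x y : mink x y = mink y x.
Proof.
rewrite !minkE (mulrC (coord l 0 x)) (mulrC (coord l 1 x)); congr (_ - _).
by apply: eq_bigr => i _; rewrite mulrC.
Qed.

Lemma minkDr x y z : mink x (y + z) = mink x y + mink x z.
Proof. by rewrite /mink mulmxDr mxE. Qed.

Lemma minkZr c x y : mink x (c *: y) = c * mink x y.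
Proof. by rewrite /mink -scalemxAr mxE. Qed.

Lemma minkNr x y : mink x (- y) = - mink x y.
Proof. by rewrite -scaleN1r minkZr mulN1r. Qed.

Lemma minkDl x y z : mink (x + y) z = mink x z + mink y z.
Proof. by rewrite minkC minkDr !(minkC z). Qed.

Lemma minkZl c x y : mink (c *: x) y = c * mink x y.
Proof. by rewrite minkC minkZr minkC. Qed.

Lemma minkNl x y : mink (- x) y = - mink x y.
Proof. by rewrite minkC minkNr minkC. Qed.

Lemma coordD j (x y : V) : coord l j (x + y) = coord l j x + coord l j y.
Proof. by rewrite /coord mxE. Qed.

Lemma coordZ j c (x : V) : coord l j (c *: x) = c * coord l j x.
Proof. by rewrite /coord mxE. Qed.

Lemma coord_vec4 a b c d j : (j <= l)%N -> coord l j (vec4 a b c d) = [:: a; b; c; d]`_j.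
Proof. by move=> lej; rewrite /coord mxE inordK. Qed.

Lemma coordP (x y : V) : (forall j, (j <= l)%N -> coord l j x = coord l j y) -> x = y.
Proof.
move=> xy; apply/colP => i.
by have := xy i; rewrite /coord inord_val; apply; rewrite -ltnS; exact: ltn_ord.
Qed.

Lemma mink_vec4 x a b c d : mink x (vec4 a b c d) =
  coord l 0 x * a + coord l 1 x * b - coord l 2 x * c - coord l 3 x * d.
Proof.
rewrite minkE !coord_vec4 //= 2!big_ord_recl big1 => [|i _]; last first.
  by rewrite coord_vec4 /= ?nth_nil ?mulr0 // !ltnS; exact: ltn_ord.
rewrite !coord_vec4 //= /bump /= !addr0; ring.
Qed.

Lemma e_uE : e_u l = vec4 1 0 0 0.
Proof.
apply: coordP => j lej; rewrite coord_vec4 // /coord mxE eqxx andbT.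
case: eqP => [/(congr1 val)|]; first by rewrite /= !inordK // => ->.
case: j lej => [|j] lej => [/(_ erefl)//|_].
by case: j lej => [|[|[|j]]] //= _; rewrite ?nth_nil.
Qed.

Lemma mink_e_u x : mink x (e_u l) = coord l 0 x.
Proof. by rewrite e_uE mink_vec4; ring. Qed.

Lemma mink_e_t x : mink x (vec4 0 1 0 0) = coord l 1 x.
Proof. by rewrite mink_vec4; ring. Qed.

Lemma mink_delta (i j : 'I_(2 + l.-1)) (A : 'M[R]_(2 + l.-1)) :
  ((delta_mx i 0 : V)^T *m A *m (delta_mx j 0 : V)) 0 0 = A i j.
Proof. by rewrite trmx_delta -rowE -colE !mxE. Qed.

Lemma det_eta_neq0 : \det eta_mx != 0.
Proof.
rewrite det_diag; apply/prodf_neq0 => i _.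
by case: (split_ordP i) => j ->; rewrite ?row_mxEl ?row_mxEr !mxE ?oppr_eq0 oner_neq0.
Qed.

(** * Isometries, reflections and representatives *)

Definition isometry (g : 'M[R]_(2 + l.-1)) : Prop :=
  forall v, qform l (g *m v) = qform l v.

Lemma isometry_mink g : isometry g ->
  forall x y, mink (g *m x) (g *m y) = mink x y.
Proof.
move=> iso x y; have := iso (x + y).
rewrite !qform_mink mulmxDr !minkDl !minkDr -!qform_mink !iso !(minkC (g *m y)) !(minkC y).
by lra.
Qed.

Lemma isometryM g h : isometry g -> isometry h -> isometry (g *m h).
Proof. by move=> ig ih v; rewrite -mulmxA ig ih. Qed.

Lemma isometry_det g : isometry g -> \det g = 1 \/ \det g = -1.
Proof.
move=> /isometry_mink iso.
have : g^T *m eta_mx *m g = eta_mx.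
  apply/matrixP => i j; rewrite -mink_delta -[RHS]mink_delta -/(mink _ _) -iso.
  by rewrite /mink trmx_mul !mulmxA.
move=> /(congr1 determinant); rewrite !det_mulmx det_tr mulrAC -[RHS]mul1r.
move=> /(mulIf det_eta_neq0) /eqP; rewrite -expr2 sqrf_eq1.
by move=> /orP[]/eqP; [left|right].
Qed.

Lemma isometry_unitmx g : isometry g -> g \in unitmx.
Proof.
by rewrite unitmxE => /isometry_det[]->; rewrite ?unitrN unitr1.
Qed.

Definition reflection (m : V) : 'M[R]_(2 + l.-1) :=
  1%:M - (2 / mink m m) *: (m *m (m^T *m eta_mx)).

Lemma reflectionE m x : reflection m *m x = x - (2 * mink m x / mink m m) *: m.
Proof.
rewrite mulmxBl mul1mx -scalemxAl -mulmxA [_ *m _ *m x]mx11_scalar.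
by rewrite -/(mink m x) mul_mx_scalar scalerA mulrAC.
Qed.

Lemma reflection_isometry m : mink m m != 0 -> isometry (reflection m).
Proof.
move=> m0 x; rewrite !qform_mink reflectionE !minkDl !minkDr !minkNl !minkNr.
by rewrite !minkZl !minkZr (minkC x m); field.
Qed.

Definition sign_mx (i : nat) : 'M[R]_(2 + l.-1) :=
  diag_mx (\row_j (-1) ^+ (j == inord i)).

Lemma coord_sign_mx i j x : (i <= l)%N -> (j <= l)%N ->
  coord l j (sign_mx i *m x) = (-1) ^+ (j == i) * coord l j x.
Proof.
move=> li lj; rewrite /coord mul_diag_mx !mxE; congr ((-1) ^+ (nat_of_bool _) * _).
by rewrite -(inj_eq val_inj) /= !inordK.
Qed.

Lemma sign_mx_isometry i : (i <= l)%N -> isometry (sign_mx i).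
Proof.
move=> li x; rewrite /qform !coord_sign_mx // !exprMn !sqrr_sign !mul1r.
congr (_ - _); apply: eq_big_nat => j /andP[_ lj].
by rewrite coord_sign_mx // exprMn sqrr_sign mul1r.
Qed.

Lemma det_sign_mx i : \det (sign_mx i) = -1.
Proof.
rewrite det_diag (bigD1 (inord i)) //= mxE eqxx big1 ?mulr1 // => j /negbTE ji.
by rewrite mxE ji.
Qed.

(** The reflection along [v - e_u] exchanges [e_u] and [v], and the one along [v + e_u] sends [e_u]
    to [- v]. The value of [mink (e_u l) v] decides which of the two vectors is certainly not null.
    A determinant -1 is repaired by flipping y, which fixes [e_u]. *)
Lemma representative_exists v : AdS R l v -> exists g, representative l g v.
Proof.
rewrite /AdS /= qform_mink => qv.
have [g ig gv] : exists2 g, isometry g & g *m e_u l = v.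
  have qe : mink (e_u l) (e_u l) = 1 by rewrite mink_e_u e_uE coord_vec4.
  have [ev|ev] := eqVneq (mink (e_u l) v) (-1).
    have qm : mink (v - e_u l) (v - e_u l) = 4.
      by rewrite !(minkDl, minkDr, minkNl, minkNr) (minkC v (e_u l)) qv qe ev; ring.
    exists (reflection (v - e_u l)); first by apply: reflection_isometry; rewrite qm pnatr_eq0.
    rewrite reflectionE qm minkDl minkNl qe (minkC v) ev.
    rewrite (_ : 2 * (-1 - 1) / 4 = - 1) ?scaleN1r; last by field.
    by rewrite opprK addrCA subrr addr0.
  have qm : mink (v + e_u l) (v + e_u l) = 2 * (1 + mink (e_u l) v).
    by rewrite !(minkDl, minkDr, minkNl, minkNr) (minkC v (e_u l)) qv qe; ring.
  have ev' : 1 + mink (e_u l) v != 0 by rewrite addrC addr_eq0.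
  have im : isometry (reflection (v + e_u l)).
    by apply: reflection_isometry; rewrite qm mulf_neq0 // pnatr_eq0.
  exists (- reflection (v + e_u l)).
    by move=> x; rewrite mulNmx qform_mink minkNl minkNr opprK -qform_mink.
  rewrite mulNmx reflectionE qm minkDl qe (minkC v).
  rewrite (_ : 2 * _ / _ = 1) ?scale1r; last by field.
  by rewrite opprB addrK.
have [dg|dg] := isometry_det _ ig; first by exists g; split.
exists (g *m sign_mx 3); split; first split.
- by rewrite det_mulmx dg det_sign_mx mulrNN mulr1.
- exact/isometryM/sign_mx_isometry.
rewrite -mulmxA -[RHS]gv; congr (_ *m _); apply: coordP => j lj.
rewrite coord_sign_mx // e_uE coord_vec4 //.
by move: lj; case: j => [|[|[|[|j]]]] //= lj; rewrite ?nth_nil ?mul1r ?mulr0.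
Qed.

(** Flipping t and y together keeps determinant 1 and fixes [e_u], but reverses the time axis. Hence
    both halves of the light cone at [v] occur as the future. *)
Lemma representative_reverse g v : representative l g v ->
  exists h, representative l h v /\
    h *m vec4 0 1 0 0 = - (g *m vec4 0 1 0 0).
Proof.
move=> [[dg ig] gv]; exists (g *m (sign_mx 1 *m sign_mx 3)); split; first split.
- split; first by rewrite !det_mulmx dg !det_sign_mx mulrNN !mulr1.
  by apply: isometryM => //; apply: isometryM; apply: sign_mx_isometry.
- rewrite -mulmxA -[RHS]gv; congr (_ *m _); apply: coordP => j lj.
  rewrite -mulmxA !coord_sign_mx // e_uE coord_vec4 //.
  by move: lj; case: j => [|[|[|[|j]]]] //= lj; rewrite ?nth_nil ?mul1r ?mulr0.
- rewrite -mulmxA -mulmxN; congr (_ *m _); apply: coordP => j lj.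
  rewrite -mulmxA !coord_sign_mx // -(scaleN1r (vec4 _ _ _ _)) coordZ coord_vec4 //.
  by move: lj; case: j => [|[|[|[|j]]]] //= lj; rewrite ?nth_nil ?mul1r ?mulr0.
Qed.

End Minkowski.

(** * Time orientation in a frame, and light rays *)

Section LightRays.
Context {R : realType} (k : nat).
Local Notation l := k.+3.
Local Notation V := 'cV[R]_(2 + l.-1).
Implicit Types (v x y z n : V) (g : 'M[R]_(2 + l.-1)) (w : 'cV[R]_(l.-1)).

(** The component along the time axis of the frame. On nonzero null vectors orthogonal to [v], its
    sign separates the two halves of the light cone. *)
Definition frame_time g x : R := mink k x (g *m vec4 k 0 1 0 0).

Lemma representativeK g v x : representative l g v -> g *m (invmx g *m x) = x.
Proof. by move=> [[_ ig] _]; rewrite mulmxA mulmxV ?mul1mx //; exact: isometry_unitmx. Qed.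

Lemma representative_mink g v x y : representative l g v ->
  mink k (g *m x) (g *m y) = mink k x y.
Proof. by move=> [[_ ig] _]; apply: isometry_mink. Qed.

Lemma representative_coord0 g v x : representative l g v ->
  coord l 0 x = mink k (g *m x) v.
Proof. by move=> hg; rewrite -mink_e_u -(representative_mink _ _ _ _ hg) hg.2. Qed.

Lemma representative_coord1 g v x : representative l g v ->
  coord l 1 x = frame_time g (g *m x).
Proof. by move=> hg; rewrite -mink_e_t -(representative_mink _ _ _ _ hg). Qed.

(** In the frame [g] both time-like components of [z] vanish, so only the negative squares
    remain. *)
Lemma mink_orth_le0 g v z : representative l g v ->
  mink k z v = 0 -> frame_time g z = 0 -> mink k z z <= 0.
Proof.
move=> hg; rewrite -(representativeK _ _ z hg) -(representative_coord0 _ _ _ hg).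
rewrite -(representative_coord1 _ _ _ hg) (representative_mink _ _ _ _ hg) => z0 z1.
rewrite minkE z0 z1 !mul0r !add0r oppr_le0.
by apply: sumr_ge0 => i _; rewrite -expr2 sqr_ge0.
Qed.

Lemma mink_orth_eq0 g v z : representative l g v ->
  mink k z v = 0 -> frame_time g z = 0 -> mink k z z = 0 -> z = 0.
Proof.
move=> hg; rewrite -(representativeK _ _ z hg) -(representative_coord0 _ _ _ hg).
rewrite -(representative_coord1 _ _ _ hg) (representative_mink _ _ _ _ hg) => z0 z1.
rewrite minkE z0 z1 !mul0r !add0r => /eqP; rewrite oppr_eq0 psumr_eq0; last first.
  by move=> i _; rewrite -expr2 sqr_ge0.
move=> /allP zi; rewrite (_ : invmx g *m z = 0) ?mulmx0 //.
apply: coordP => j lj; rewrite [RHS]mxE; case: j lj => [|[|j]] lj //.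
have := zi (Ordinal (lj : (j < l.-1)%N)) (mem_index_enum _).
by rewrite /= mulf_eq0 orbb => /eqP.
Qed.

(* [frame_time g y *: x - frame_time g x *: y] is orthogonal to [v] and to
   [g e_t], hence not time-like. *)
Lemma reverse_cauchy_schwarz g v x y : representative l g v ->
  mink k x v = 0 -> mink k y v = 0 ->
  frame_time g y ^+ 2 * mink k x x + frame_time g x ^+ 2 * mink k y y
  <= 2 * frame_time g x * frame_time g y * mink k x y.
Proof.
move=> hg xv yv; set a := frame_time g x; set b := frame_time g y.
have : mink k (b *: x - a *: y) (b *: x - a *: y) <= 0.
  apply: (mink_orth_le0 _ _ _ hg).
    by rewrite minkDl minkNl !minkZl xv yv; ring.
  by rewrite /frame_time minkDl minkNl !minkZl -/(frame_time g x) -/(frame_time g y) -/a -/b; ring.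
rewrite !minkDl !minkDr !minkNl !minkNr !minkZl !minkZr (minkC k y x); lra.
Qed.

Lemma null_time_neq0 g v n : representative l g v ->
  mink k n v = 0 -> mink k n n = 0 -> n <> 0 -> frame_time g n != 0.
Proof. by move=> hg nv nn n0; apply/eqP => t0; apply: n0; exact: mink_orth_eq0 hg _ _ _. Qed.

(** The velocity of the ray with direction [w], read in the frame. Its time component is -1, so
    future rays fill the half cone of negative [frame_time]. *)
Definition null_dir w : V := col_mx (\col_(i < 2) [:: 0; -1]`_i) w.

Lemma coord_null_dir w :
  [/\ coord l 0 (null_dir w) = 0, coord l 1 (null_dir w) = -1 &
   forall i : 'I_(l.-1), coord l i.+2 (null_dir w) = w i 0].
Proof.
split=> [||i]; rewrite /coord /null_dir -?rshift_inord ?col_mxEd //.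
  by rewrite -(lshift_inord _ ord0) col_mxEu mxE.
by rewrite -(lshift_inord _ (lift ord0 ord0)) col_mxEu mxE.
Qed.

Lemma mink_null_dir w : directions l w -> mink k (null_dir w) (null_dir w) = 0.
Proof.
rewrite /directions /= => dw; have [c0 c1 ci] := coord_null_dir w.
rewrite minkE c0 c1 (eq_bigr (fun i => w i 0 ^+ 2)) => [|i _]; last by rewrite ci expr2.
by rewrite dw; ring.
Qed.

Lemma null_dirP x : coord l 0 x = 0 -> coord l 1 x = -1 -> mink k x x = 0 ->
  exists2 w, directions l w & null_dir w = x.
Proof.
move=> x0 x1 xx; exists (\col_i coord l i.+2 x).
  move: xx; rewrite /directions /= minkE x0 x1.
  rewrite (eq_bigr (fun i : 'I_(l.-1) => coord l i.+2 x ^+ 2)) => [|i _]; last by rewrite expr2.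
  under [X in _ -> X = _]eq_bigr do rewrite mxE.
  by move=> ?; lra.
have [c0 c1 ci] := coord_null_dir (\col_i coord l i.+2 x).
apply: coordP => -[|[|j]] lj; rewrite ?c0 ?c1 ?x0 ?x1 //.
by rewrite (ci (Ordinal (lj : (j < l.-1)%N))) mxE.
Qed.

Lemma ray_direction g v w : representative l g v -> directions l w ->
  [/\ mink k (g *m null_dir w) v = 0,
      mink k (g *m null_dir w) (g *m null_dir w) = 0 &
      frame_time g (g *m null_dir w) = -1].
Proof.
move=> hg dw; have [c0 c1 _] := coord_null_dir w.
rewrite -(representative_coord0 _ _ _ hg) -(representative_coord1 _ _ _ hg).
by rewrite (representative_mink _ _ _ _ hg) mink_null_dir.
Qed.

(** A positive rescaling brings the frame time of [n] to -1, the normalization of [null_dir]. *)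
Lemma direction_of_null g v n : representative l g v ->
  mink k n v = 0 -> mink k n n = 0 -> frame_time g n < 0 ->
  exists2 w, directions l w & g *m null_dir w = (- frame_time g n)^-1 *: n.
Proof.
move=> hg nv nn t0; set x := (- _)^-1 *: n.
have tN : frame_time g n != 0 by rewrite lt_eqF.
have [||| w dw wx] := null_dirP (invmx g *m x).
- by rewrite (representative_coord0 _ _ _ hg) (representativeK _ _ _ hg) minkZl nv mulr0.
- rewrite (representative_coord1 _ _ _ hg) (representativeK _ _ _ hg).
  by rewrite /frame_time minkZl -/(frame_time g n) invrN mulNr mulVf.
- rewrite -(representative_mink _ _ _ _ hg) (representativeK _ _ _ hg).
  by rewrite minkZl minkZr nn !mulr0.
by exists w => //; rewrite wx (representativeK _ _ _ hg).
Qed.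

Lemma lightlikeE g v w s : representative l g v ->
  lightlike l g w s = v + s *: (g *m null_dir w).
Proof.
move=> [_ <-]; rewrite /lightlike scalemxAr -mulmxDr; congr (_ *m _).
have [c0 c1 ci] := coord_null_dir w.
apply: coordP => -[|[|j]] lj; rewrite coordD coordZ ?c0 ?c1.
- rewrite e_uE coord_vec4 // /coord -(lshift_inord _ ord0) col_mxEu mxE /=; ring.
- rewrite e_uE coord_vec4 // /coord -(lshift_inord _ (lift ord0 ord0)) col_mxEu mxE /=; ring.
rewrite (ci (Ordinal (lj : (j < l.-1)%N))) e_uE coord_vec4 //.
rewrite /coord -(rshift_inord _ (Ordinal (lj : (j < l.-1)%N))) col_mxEd mxE.
by rewrite (_ : _`_j.+2 = 0) ?add0r //; case: j {lj} => [|[|j]] //=; rewrite nth_nil.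
Qed.

(** * The black hole in the coordinates a ([coordB]) and b ([coordS]) *)

Definition coordB x : R := coord l 1 x - coord l 3 x.
Definition coordS x : R := coord l 1 x + coord l 3 x.

Lemma singularityE x : AdS R l x -> singularity R l x <-> coordB x * coordS x = 0.
Proof.
move=> ax; rewrite /singularity /= /coordB /coordS -subr_sqr.
by split=> [[]|].
Qed.

(** Along a ray a and b are affine in s, and both are nonzero at [v] because [v] is off the
    singularity. One of them therefore vanishes at some s > 0 exactly when its initial value and its
    slope have opposite signs. *)
Lemma black_holeP v : black_hole R l v <-> BTZ R l v /\
  exists2 g, representative l g v & forall w, directions l w ->
    coordB v * coordB (g *m null_dir w) < 0 \/
    coordS v * coordS (g *m null_dir w) < 0.
Proof.
(* The velocity is null and orthogonal to [v], so the quadratic form is constant along the ray. *)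
have AdS_ray g w s : AdS R l v -> representative l g v -> directions l w ->
    AdS R l (v + s *: (g *m null_dir w)).
  rewrite /AdS /= !qform_mink => vv hg dw; have [nv nn _] := ray_direction _ _ _ hg dw.
  by rewrite !minkDl !minkDr !minkZl !minkZr (minkC k v) vv nv nn; ring.
have coord_ray s n : (coordB (v + s *: n) = coordB v + s * coordB n) *
    (coordS (v + s *: n) = coordS v + s * coordS n).
  by rewrite /coordB /coordS !coordD !coordZ; split; ring.
split=> [[bv nf]|[bv [g hg H]]]; split=> //.
- have [av /(singularityE _ av)/eqP] := bv.
  rewrite mulf_eq0 negb_or => /andP[a0 b0].
  apply: contrapT => nex; apply: nf; split=> // g hg.
  apply: contrapT => nw; apply: nex; exists g => // w dw.
  apply: contrapT => nab; apply: nw; exists w => // s s0.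
  rewrite (lightlikeE _ _ _ _ hg) => /(singularityE _ (AdS_ray _ _ _ av hg dw)).
  rewrite !coord_ray; set n := g *m _ in nab *.
  have [Bn Sn] : 0 <= coordB v * coordB n /\ 0 <= coordS v * coordS n.
    by split; rewrite leNgt; apply/negP => h; apply: nab; [left|right].
  have Bv : 0 < coordB v * coordB v by rewrite -expr2 exprn_even_gt0.
  have Sv : 0 < coordS v * coordS v by rewrite -expr2 exprn_even_gt0.
  move=> /eqP; rewrite mulf_eq0 => /orP[]/eqP e.
    have : coordB v * (coordB v + s * coordB n) = 0 by rewrite e mulr0.
    by have := mulr_ge0 (ltW s0) Bn; lra.
  have : coordS v * (coordS v + s * coordS n) = 0 by rewrite e mulr0.
  by have := mulr_ge0 (ltW s0) Sn; lra.
move=> [_ /(_ g hg)[w dw nh]]; have av := bv.1; set n := g *m null_dir w in nh *.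
have hit (a b s : R) : a * b < 0 -> s = - (a / b) -> 0 < s /\ a + s * b = 0.
  move=> ab ->; have b0 : b != 0 by apply: contraTneq ab => ->; rewrite mulr0 ltxx.
  split; last by field.
  have -> : - (a / b) = - (a * b) / b ^+ 2 by field.
  by rewrite divr_gt0 ?oppr_gt0 // exprn_even_gt0.
case: (H w dw) => /hit/(_ erefl)[s0 e]; apply: (nh _ s0);
  rewrite (lightlikeE _ _ _ _ hg); apply/(singularityE _ (AdS_ray _ _ _ av hg dw));
  by rewrite !coord_ray e ?mul0r ?mulr0.
Qed.

Lemma black_hole_sufficient (u t x y : R) :
  let v := vec4 k u t x y in AdS R l v -> 0 < t ^+ 2 - y ^+ 2 < 1 -> black_hole R l v.
Proof.
move=> v av; set f := _ - _ => /andP[f0 f1].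
have vc : u ^+ 2 - x ^+ 2 = 1 - f.
  move: av; rewrite /AdS /= qform_mink mink_vec4 !coord_vec4 //= /f; lra.
have fE : f = t ^+ 2 - y ^+ 2 by [].
have Bv : coordB v = t - y by rewrite /coordB !coord_vec4.
have Sv : coordS v = t + y by rewrite /coordS !coord_vec4.
have BS : coordB v * coordS v = f by rewrite Bv Sv -subr_sqr.
apply/black_holeP; split.
  by split=> // /(singularityE _ av); rewrite BS => f00; rewrite f00 ltxx in f0.
(* [N] is (0, t, 0, y) - f v, the projection of (0, t, 0, y) to the orthogonal complement of [v].
   Pairing it with a vector orthogonal to [v] thus involves only t and y. *)
pose N : V := vec4 k (- (f * u)) (t * (1 - f)) (- (f * x)) (y * (1 - f)).
have Nv : mink k N v = 0.
  rewrite mink_vec4 !coord_vec4 //=.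
  have -> : - (f * u) * u + t * (1 - f) * t - - (f * x) * x - y * (1 - f) * y =
    - f * (u ^+ 2 - x ^+ 2) + (1 - f) * (t ^+ 2 - y ^+ 2) by ring.
  by rewrite vc -fE; ring.
have NN : mink k N N = f * (1 - f).
  rewrite mink_vec4 !coord_vec4 //=.
  have -> : - (f * u) * - (f * u) + t * (1 - f) * (t * (1 - f)) - - (f * x) * - (f * x)
    - y * (1 - f) * (y * (1 - f)) =
    f ^+ 2 * (u ^+ 2 - x ^+ 2) + (1 - f) ^+ 2 * (t ^+ 2 - y ^+ 2) by ring.
  by rewrite vc -fE; ring.
have NN0 : 0 < mink k N N by rewrite NN mulr_gt0 // subr_gt0.
(* A time-like [N] has nonzero frame time, so some representative makes it positive. Future rays
   have frame time -1 and then lie opposite to [N], which makes [mink k n N] negative below. *)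
have [g hg gN] : exists2 g, representative l g v & 0 < frame_time g N.
  have [g hg] := representative_exists _ _ av.
  have [|gN|gN] := ltgtP (frame_time g N) 0; last 2 first.
  - by exists g.
  - by have := mink_orth_le0 _ _ _ hg Nv gN; rewrite leNgt NN0.
  move=> gN; have [h [hh hE]] := representative_reverse _ _ _ hg.
  by exists h => //; rewrite /frame_time hE minkNr oppr_gt0.
exists g => // w dw; have [nv nn nt] := ray_direction _ _ _ hg dw.
set n := g *m null_dir w in nv nn nt *.
have nN : mink k n N < 0.
  have := reverse_cauchy_schwarz _ _ _ _ hg nv Nv.
  rewrite nn nt mulr0 add0r sqrrN expr1n mul1r => h.
  have {h} : frame_time g N * mink k n N < 0 by lra.
  by rewrite pmulr_rlt0.
have nE : mink k n N = coord l 1 n * t - coord l 3 n * y.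
  move: nv; rewrite !mink_vec4 => nv.
  by apply/eqP; rewrite -subr_eq0; apply/eqP; rewrite -[RHS](mulr0 (- f)) -nv; ring.
have key : (coordB v * coordB n) * coordS v ^+ 2 + (coordS v * coordS n) * coordB v ^+ 2
    = 2 * f * mink k n N.
  by rewrite nE -BS Bv Sv /coordB /coordS; ring.
have neg : 2 * f * mink k n N < 0 by rewrite pmulr_rlt0 // mulr_gt0.
have [|B0] := ltP (coordB v * coordB n) 0; first by left.
have [|S0] := ltP (coordS v * coordS n) 0; first by right.
have := mulr_ge0 B0 (sqr_ge0 (coordS v)); have := mulr_ge0 S0 (sqr_ge0 (coordB v)).
lra.
Qed.

Lemma not_black_hole v :
  (forall g, representative l g v -> exists n, [/\ mink k n v = 0, mink k n n = 0,
     frame_time g n < 0, 0 <= coordB v * coordB n & 0 <= coordS v * coordS n]) ->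
  ~ black_hole R l v.
Proof.
move=> H /black_holeP[_ [g hg] G]; have [n [nv nn nt Bn Sn]] := H g hg.
have [w dw wn] := direction_of_null _ _ _ hg nv nn nt.
have c0 : 0 < (- frame_time g n)^-1 by rewrite invr_gt0 oppr_gt0.
have BZ : coordB (g *m null_dir w) = (- frame_time g n)^-1 * coordB n.
  by rewrite wn /coordB !coordZ mulrBr.
have SZ : coordS (g *m null_dir w) = (- frame_time g n)^-1 * coordS n.
  by rewrite wn /coordS !coordZ mulrDr.
case: (G w dw); rewrite ?BZ ?SZ mulrCA pmulr_rlt0 // ltNge => /negP; exact.
Qed.

(** By [reverse_cauchy_schwarz], a negative product puts the null vectors [n] and [m] in opposite
    half cones. Whatever the representative, one of them then points to the future. *)
Lemma not_black_hole_pair v n m :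
  mink k n v = 0 -> mink k n n = 0 -> 0 <= coordB v * coordB n -> 0 <= coordS v * coordS n ->
  mink k m v = 0 -> mink k m m = 0 -> 0 <= coordB v * coordB m -> 0 <= coordS v * coordS m ->
  mink k n m < 0 -> ~ black_hole R l v.
Proof.
move=> nv nn Bn Sn mv mm Bm Sm nm; apply: not_black_hole => g hg.
have [tn|tn] := ltP (frame_time g n) 0; first by exists n.
exists m; split=> //; rewrite ltNge; apply/negP => tm.
have n0 : n <> 0 by move=> n0; move: nm; rewrite n0 -(scale0r n) minkZl mul0r ltxx.
have m0 : m <> 0 by move=> m0; move: nm; rewrite m0 -(scale0r m) minkZr mul0r ltxx.
have {}tn : 0 < frame_time g n by rewrite lt0r tn (null_time_neq0 _ _ _ hg).
have {}tm : 0 < frame_time g m by rewrite lt0r tm (null_time_neq0 _ _ _ hg).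
have := reverse_cauchy_schwarz _ _ _ _ hg nv mv.
rewrite nn mm !mulr0 addr0 pmulr_rge0 ?mulr_gt0 //; lra.
Qed.

Lemma black_hole_necessary (u t x y : R) :
  let v := vec4 k u t x y in black_hole R l v -> 0 < t ^+ 2 - y ^+ 2 < 1.
Proof.
move=> v bh; have [[av nsing] _] := bh; move: bh; apply: contraPP => /negP nf.
pose a := t - y; pose b := t + y; pose f := t ^+ 2 - y ^+ 2.
have Bv : coordB v = a by rewrite /coordB !coord_vec4.
have Sv : coordS v = b by rewrite /coordS !coord_vec4.
have fab : f = a * b by rewrite /f /a /b; ring.
have [a0 b0] : a != 0 /\ b != 0.
  apply/andP; rewrite -negb_or -mulf_eq0 -Bv -Sv; apply/eqP => f0.
  by apply: nsing; apply/(singularityE _ av).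
have vc : u ^+ 2 - x ^+ 2 = 1 - f.
  move: av; rewrite /AdS /= qform_mink mink_vec4 !coord_vec4 //= /f; lra.
have coordBE c0 c1 c2 c3 : coordB (vec4 k c0 c1 c2 c3) = c1 - c3 by rewrite /coordB !coord_vec4.
have coordSE c0 c1 c2 c3 : coordS (vec4 k c0 c1 c2 c3) = c1 + c3 by rewrite /coordS !coord_vec4.
have minkv4 c0 c1 c2 c3 d0 d1 d2 d3 :
    mink k (vec4 k c0 c1 c2 c3) (vec4 k d0 d1 d2 d3) =
    c0 * d0 + c1 * d1 - c2 * d2 - c3 * d3 by rewrite mink_vec4 !coord_vec4.
have [f0|f0] := ltP f 0.
  (* [m 1] and [m (-1)] span the two null lines orthogonal to [v] in the span of
     [e_t], [e_y] and [v]. *)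
  pose s := Num.sqrt (1 - f).
  have ss : s ^+ 2 = 1 - f by rewrite sqr_sqrtr //; lra.
  have s1 : 1 < s by rewrite -sqrtr1 ltr_sqrt; lra.
  (* With u and x kept, orthogonality to [v] reads alpha b + beta a = - 2 s^2 and nullity reads
     alpha beta = - s^2. So alpha b and beta a are the two numbers - s^2 + s and - s^2 - s, in an
     order chosen by [e]. *)
  pose alpha (e : R) := - (s ^+ 2 + e * s) / b.
  pose beta (e : R) := - (s ^+ 2 - e * s) / a.
  pose m (e : R) : V := vec4 k u ((alpha e + beta e) / 2) x ((beta e - alpha e) / 2).
  have Bm e : coordB (m e) = alpha e by rewrite coordBE; field.
  have Sm e : coordS (m e) = beta e by rewrite coordSE; field.
  have mv e : mink k (m e) v = 0.
    have -> : mink k (m e) v = (u ^+ 2 - x ^+ 2) + (alpha e * b + beta e * a) / 2.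
      by rewrite minkv4 /a /b; field.
    by rewrite vc -ss /alpha /beta; field; rewrite a0 b0.
  have mm e e' : mink k (m e) (m e') = s ^+ 2 * (f + s ^+ 2 - e * e') / f.
    have -> : mink k (m e) (m e') =
        (u ^+ 2 - x ^+ 2) + (alpha e * beta e' + beta e * alpha e') / 2.
      by rewrite minkv4; field.
    by rewrite vc -ss fab /alpha /beta; field; rewrite a0 b0.
  have Bpos e : 0 <= s + e -> 0 <= coordB v * coordB (m e).
    move=> se; rewrite Bv Bm.
    have -> : a * alpha e = - f * (s * (s + e)) / b ^+ 2 by rewrite fab /alpha; field.
    by rewrite divr_ge0 ?sqr_ge0 // !mulr_ge0 //; lra.
  have Spos e : 0 <= s - e -> 0 <= coordS v * coordS (m e).
    move=> se; rewrite Sv Sm.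
    have -> : b * beta e = - f * (s * (s - e)) / a ^+ 2 by rewrite fab /beta; field.
    by rewrite divr_ge0 ?sqr_ge0 // !mulr_ge0 //; lra.
  apply: (not_black_hole_pair _ (m 1) (m (-1))) => //.
  - by rewrite mm ss; field; rewrite lt_eqF.
  - by apply: Bpos; lra.
  - by apply: Spos; lra.
  - by rewrite mm ss; field; rewrite lt_eqF.
  - by apply: Bpos; lra.
  - by apply: Spos; lra.
  rewrite mm ss (_ : _ / f = 2 * (1 - f) / f); last by field; rewrite lt_eqF.
  by rewrite pmulr_rlt0 ?invr_lt0 // mulr_gt0 //; lra.
have fN0 : f != 0 by rewrite fab mulf_neq0.
have {nf f0} f1 : 1 <= f.
  by rewrite leNgt; apply: contraNN nf => f1; rewrite f1 lt0r fN0 f0.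
(* At f = 1 one has u^2 = x^2, and the null vectors [m c] have a = b = 0, so neither factor changes
   along their rays. As [m 1] and [m (-1)] are opposite, their product is 0 and the pair criterion
   does not apply; the sign of the frame time chooses between them. *)
have [f1'|f1'] := eqVneq f 1.
  have [e [e2 xe]] : exists e : R, e ^+ 2 = 1 /\ x = e * u.
    have /eqP : x ^+ 2 = u ^+ 2 by move: vc; rewrite f1'; lra.
    rewrite eqf_sqr => /orP[]/eqP ->; [exists 1|exists (-1)].
      by rewrite expr1n mul1r.
    by rewrite sqrrN expr1n mulN1r.
  pose m (c : R) : V := vec4 k c 0 (c * e) 0.
  have mm c : mink k (m c) (m c) = 0.
    have -> : mink k (m c) (m c) = c ^+ 2 * (1 - e ^+ 2) by rewrite minkv4; ring.
    by rewrite e2 subrr mulr0.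
  have mv c : mink k (m c) v = 0.
    have -> : mink k (m c) v = c * u * (1 - e ^+ 2) by rewrite minkv4 xe; ring.
    by rewrite e2 subrr mulr0.
  have Bm c : coordB (m c) = 0 by rewrite coordBE subr0.
  have Sm c : coordS (m c) = 0 by rewrite coordSE addr0.
  have mN : m (-1) = - m 1.
    apply: coordP => j lj; rewrite -(scaleN1r (m 1)) coordZ !coord_vec4 //.
    by case: j lj => [|[|[|[|j]]]] lj /=; rewrite ?nth_nil; ring.
  apply: not_black_hole => g hg.
  have t0 : frame_time g (m 1) != 0.
    apply: (null_time_neq0 _ _ _ hg) => // /(congr1 (coord l 0)).
    by rewrite coord_vec4 // /coord mxE /=; apply/eqP; rewrite oner_neq0.
  have [tm|tm|tm] := ltgtP (frame_time g (m 1)) 0.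
  - by exists (m 1); rewrite Bm Sm !mulr0.
  - exists (m (-1)); rewrite Bm Sm !mulr0; split=> //.
    by rewrite mN /frame_time minkNl oppr_lt0.
  - by rewrite tm eqxx in t0.
have {f1 f1'} f1 : 1 < f by rewrite lt_neqAle eq_sym f1' f1.
(* [m e] is [- N / f] corrected by a multiple of the time-like vector
   [(x, 0, u, 0)], which is orthogonal to [v], [e_t] and [e_y]. *)
pose r := Num.sqrt f^-1.
(* This value makes [m e] null for e = 1 and e = -1: - N / f has square (1 - f) / f, and r (x, 0, u,
   0), orthogonal to it, has square r^2 (f - 1). *)
have rr : r ^+ 2 = f^-1 by rewrite sqr_sqrtr // invr_ge0; lra.
pose c := 1 - f^-1.
have c0 : 0 < c by rewrite subr_gt0 invf_lt1 //; lra.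
pose m (e : R) : V := vec4 k (u + e * r * x) (t * c) (x + e * r * u) (y * c).
have mv e : mink k (m e) v = 0.
  have -> : mink k (m e) v = (u ^+ 2 - x ^+ 2) + c * f by rewrite minkv4 /f; ring.
  by rewrite vc /c; field.
have mm e e' : mink k (m e) (m e') = (f - 1) / f * (e * e' - 1).
  have -> : mink k (m e) (m e') =
      (u ^+ 2 - x ^+ 2) * (1 - e * e' * r ^+ 2) + c ^+ 2 * f by rewrite minkv4 /f; ring.
  by rewrite vc rr /c; field.
have Bm e : 0 <= coordB v * coordB (m e).
  by rewrite Bv coordBE -mulrBl mulrA mulr_ge0 ?(ltW c0) // -expr2 sqr_ge0.
have Sm e : 0 <= coordS v * coordS (m e).
  by rewrite Sv coordSE -mulrDl mulrA mulr_ge0 ?(ltW c0) // -expr2 sqr_ge0.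
apply: (not_black_hole_pair _ (m 1) (m (-1))) => //.
- by rewrite mm; ring.
- by rewrite mm; ring.
rewrite mm nmulr_llt0 ?divr_gt0; lra.
Qed.

End LightRays.

(** * The inclusion of AdS_3 in AdS_4 and the horizon *)

Section Inclusion.
Context {R : realType}.
Local Notation V3 := 'cV[R]_(2 + 3.-1).

(** The first argument of [vec4] is l - 3, hence 0 for AdS_3 and 1 for AdS_4. *)
Lemma vec4_coord (v : V3) :
  v = vec4 0 (coord 3 0 v) (coord 3 1 v) (coord 3 2 v) (coord 3 3 v).
Proof. by apply: coordP => j lj; rewrite coord_vec4 //; case: j lj => [|[|[|[|j]]]]. Qed.

Lemma coord_incl34 j (v : V3) : (j <= 4)%N ->
  coord 4 j (incl34 v) = if (j < 4)%N then coord 3 j v else 0.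
Proof.
move=> lj; rewrite /incl34 /coord; case: ltnP => j4.
  rewrite (_ : inord j = lshift 1 (inord j : 'I_4)); last first.
    by apply/val_inj; rewrite /= !inordK // ltnW.
  by rewrite (@col_mxEu _ 4 1).
rewrite (_ : inord j = rshift 4 (ord0 : 'I_1)); last first.
  by apply/val_inj; rewrite /= inordK //; apply/eqP; rewrite eqn_leq lj j4.
by rewrite (@col_mxEd _ 4 1) mxE.
Qed.

Lemma incl34_vec4 (v : V3) :
  incl34 v = vec4 1 (coord 3 0 v) (coord 3 1 v) (coord 3 2 v) (coord 3 3 v).
Proof.
apply: coordP => j lj; rewrite coord_vec4 // coord_incl34 //.
by case: j lj => [|[|[|[|j]]]] //= _; rewrite nth_nil.
Qed.

Lemma black_hole3E v :
  black_hole R 3 v <-> AdS R 3 v /\ 0 < coord 3 1 v ^+ 2 - coord 3 3 v ^+ 2 < 1.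
Proof.
rewrite {1 2}[v]vec4_coord; split=> [bh|[av]]; last exact: black_hole_sufficient.
by split; [exact: bh.1.1|exact: black_hole_necessary bh].
Qed.

Lemma AdS_incl34 v : AdS R 4 (incl34 v) <-> AdS R 3 v.
Proof.
rewrite incl34_vec4 {5}[v]vec4_coord /AdS /=.
by rewrite (qform_mink 1) (qform_mink 0) !mink_vec4 !coord_vec4.
Qed.

Lemma BTZ_incl34 v : BTZ R 4 (incl34 v) <-> BTZ R 3 v.
Proof.
by rewrite /BTZ /singularity /= !AdS_incl34 !coord_incl34.
Qed.

(** The same inequality on t and y describes both sides. For the horizon, one direction transports
    the closure and the other the complement of the interior. *)
Lemma black_hole_incl34 v : black_hole R 4 (incl34 v) <-> black_hole R 3 v.
Proof.
rewrite black_hole3E -AdS_incl34 incl34_vec4.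
split=> [bh|[av]]; last exact: black_hole_sufficient.
by split; [exact: bh.1.1|exact: black_hole_necessary bh].
Qed.

(** A neighborhood of a matrix contains a product of neighborhoods of its entries, and finitely many
    conditions can be met at once. *)
Lemma mx_continuous (T S : topologicalType) m n (f : T -> 'M[S]_(m, n)) :
  (forall i j, continuous (fun x => f x i j)) -> continuous f.
Proof.
move=> cf x A [P xP PA].
have : \forall y \near x, forall ij : 'I_m * 'I_n, P ij.1 ij.2 (f y ij.1 ij.2).
  by apply: filter_forall => -[i j]; exact: cf.
by apply: filterS => y yP; apply: PA => i j; exact: (yP (i, j)).
Qed.

Lemma incl34_continuous : continuous (@incl34 R).
Proof.
apply: mx_continuous => i j.
have -> : (fun v => incl34 v i j) =
    (fun v : V3 => if (i < 4)%N then coord 3 i v else 0).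
  apply/funext => v; rewrite ord1 -coord_incl34 -1?ltnS ?ltn_ord // /coord; congr (incl34 v _ _).
  by apply/val_inj; rewrite /= inordK.
by case: (i < 4)%N; [exact: coord_continuous|exact: cst_continuous].
Qed.

(** The black hole is the preimage in AdS_3 of an open interval under the continuous f. Hence no
    horizon point belongs to it. *)
Lemma black_hole3_open v : black_hole R 3 v ->
  \forall v' \near v, BTZ R 3 v' -> black_hole R 3 v'.
Proof.
move=> /black_hole3E[_ fv].
have cf : continuous (fun v : V3 => coord 3 1 v ^+ 2 - coord 3 3 v ^+ 2).
  have cc j : continuous (fun v : V3 => coord 3 j v) by exact: coord_continuous.
  have cc2 j : continuous (fun v : V3 => coord 3 j v ^+ 2).
    move=> x; apply: (@continuous_comp _ _ _ (fun v : V3 => coord 3 j v) (fun c : R => c ^+ 2)).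
      exact: cc.
    exact: exprn_continuous.
  by move=> x; exact: (cvgB (cc2 1%N x) (cc2 3%N x)).
have : \forall v' \near v, coord 3 1 v' ^+ 2 - coord 3 3 v' ^+ 2 \in `]0, 1[.
  have f01 : nbhs (coord 3 1 v ^+ 2 - coord 3 3 v ^+ 2) `]0, 1[%classic.
    by apply: open_nbhs_nbhs; split; [exact: interval_open|rewrite /= in_itv].
  exact: (cf v _ f01).
apply: filterS => v'; rewrite in_itv /= => fv' [av' _].
exact/black_hole3E.
Qed.

End Inclusion.

Theorem corollary7 (R : realType) :
  incl34 @` black_hole R 3 `<=` black_hole R 4 /\
  incl34 @` horizon R 3 `<=` horizon R 4.
Proof.
split=> _ [v hv <-]; first exact/black_hole_incl34.
have [cv iv] := hv.
(* Outside [BTZ R 3] the singleton of [v] would be a neighborhood, and it would have to meet the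
   black hole. *)
have bv : BTZ R 3 v.
  apply: contrapT => nv.
  have [|w [[bw _] wv]] := cv [set v].
    by rewrite /nbhs /= -(nbhs_subspace_out nv) => ? ->.
  by rewrite wv in bw.
split.
(* Closure: a relative neighborhood of the image pulls back to a relative neighborhood of [v], which
   meets the black hole of AdS_3. *)
- move=> B; rewrite /nbhs /= -nbhs_subspace_in; last exact/BTZ_incl34.
  move=> /(incl34_continuous v) nB.
  have {}nB : \forall w \near v, BTZ R 4 (incl34 w) -> B (incl34 w) by exact: nB.
  have [|w [bw Bw]] := cv [set w | B (incl34 w)].
    rewrite /nbhs /= -(nbhs_subspace_in bv).
    by apply: filterS nB => w Bw /BTZ_incl34.
  by exists (incl34 w); split=> //; exact/black_hole_incl34.
(* An interior point of the black hole of AdS_4 lies in it, so [v] would lie in the relatively open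
   black hole of AdS_3, hence in its interior. *)
- move=> /nbhs_singleton/black_hole_incl34/black_hole3_open bh; apply: iv.
  by rewrite /interior /nbhs /= -(nbhs_subspace_in bv).
Qed.
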